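(* Let $(G,N)$ be an equal order pair such that $N$ is nilpotent, and let $\overline{G} = G/N$. Then, for every prime divisor $p$ of $|N|$, both $\overline{G}$ and $\overline{G}/\mathbf{O}_p(\overline{G})$ are $p'$-semiregular over $\mathrm{GF}(p)$.
   Context: All groups are finite. If $G$ is a finite group and $N$ is a proper, nontrivial, normal subgroup of $G$, the pair $(G,N)$ is called an equal order pair if, for every $x \in G \setminus N$, all elements of the coset $xN$ have the same order as $x$. For a prime $p$ and a field $\mathbb{F}$, a finite group $H$ is called $p'$-semiregular over $\mathbb{F}$ if there exists a nonzero finite-dimensional $\mathbb{F}H$-module $V$ such that the centralizer in $V$ of every nontrivial $p'$-element of $H$ (element of order not divisible by $p$) is trivial. $\mathbf{O}_p(H)$ denotes the largest normal $p$-subgroup of $H$, and $\mathrm{GF}(p)$ the field with $p$ elements. *)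

(* Defs.v *)
From HB Require Import structures.
From mathcomp Require Import all_boot all_order all_fingroup all_algebra.
From mathcomp Require Import all_solvable all_field all_character.

Set Implicit Arguments.
Unset Strict Implicit.
Unset Printing Implicit Defensive.

Local Open Scope group_scope.

Definition equal_order_pair (gT : finGroupType) (G N : {group gT}) : Prop :=
  [/\ N <| G, N \proper G, N :!=: 1
    & forall x y : gT, x \in G :\: N -> y \in x *: N -> #[y] = #[x]].

(* A finite-dimensional FH-module of dimension n is given as a matrix         *)
(* representation acting on 'rV[F]_n; the row space of rfix_mx rH [set x] is  *)
(* the centralizer of x in that module.                                       *)
Definition p'_semiregular (p : nat) (F : fieldType) (gT : finGroupType)
    (H : {group gT}) : Prop :=
  exists (n : nat) (rH : mx_representation F H n),
    (0 < n)%N /\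
    forall x : gT, x \in H -> x != 1 -> ~~ (p %| #[x])%N ->
      rfix_mx rH [set x] = 0%R.

(* Main.v *)
Require Import Defs.
From HB Require Import structures.
From mathcomp Require Import all_boot all_order all_fingroup all_algebra.
From mathcomp Require Import all_solvable all_field all_character.

(** Let [E] be the subgroup of elements of order dividing [p] in the centre of
    the Sylow [p]-subgroup of [N].  Since [N] is nilpotent it centralises [E],
    so [G / N] acts on the nonzero ['F_p]-space [E].  A nontrivial [p']-element
    of [G / N] lifts to a [p']-element [x] outside [N]; if [x] centralised some
    [v != 1] in [E], then [x * v] would have order [p * #[x]], contradicting the
    equal order condition.  For the quotient by ['O_p(G / N)], restrict the
    action to the fixed points of ['O_p(G / N)], which are nonzero because the
    characteristic is [p]. *)

Import GRing.Theory.
Local Open Scope group_scope.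

(** Any preimage may be replaced by its [p^']-constituent: the quotient map commutes with
    constituents, and [y] is its own [p^']-constituent. *)
Lemma p'_elt_lift {gT : finGroupType} {G H : {group gT}} {p : nat}
    {y : coset_of H} :
  G \subset 'N(H) -> y \in G / H -> p^'.-elt y ->
  exists x, [/\ x \in G, p^'.-elt x & y = coset H x].
Proof.
move=> nHG /morphimP[x Nx Gx ->] p'x; exists x.`_p^'; split.
- by rewrite groupX.
- exact: p_elt_constt.
- by rewrite -[LHS](constt_p_elt p'x) -morph_constt.
Qed.

Lemma rfix_mx_set1_eq0 {F : fieldType} {gT : finGroupType} {G : {group gT}}
    {n : nat} (rG : mx_representation F G n) (x : gT) :
  (rfix_mx rG [set x] = 0)%R <->
  (forall v : 'rV[F]_n, v *m rG x = v -> v = 0)%R.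
Proof.
split=> [fix0 v vx | fix0].
  apply/eqP; rewrite -submx0 -fix0.
  by apply/rfix_mxP=> _ /set1P->.
apply/row_matrixP=> i; rewrite row0; apply: fix0.
by have /rfix_mxP := row_sub i (rfix_mx rG [set x]); apply; rewrite set11.
Qed.

Lemma p'_semiregular_quo_pcore (p : nat) (F : fieldType) (gT : finGroupType)
    (H : {group gT}) :
  p \in [pchar F]%R -> p'_semiregular p F H ->
  p'_semiregular p F (H / 'O_p(H))%G.
Proof.
move=> pcharF [n [rH [n_gt0 fixH]]].
have p_pr : prime p := pcharf_prime pcharF.
have nOH : H \subset 'N('O_p(H)) := gFnorm _ _.
pose U := rfix_mx rH 'O_p(H).
have modU : mxmodule rH U := normal_rfix_mx_module rH (pcore_normal p H).
have kerU : 'O_p(H) \subset rker (submod_repr modU).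
  by rewrite rker_submod rfix_mx_rstabC ?pcore_sub.
exists (\rank U), (quo_repr kerU nOH); split.
  by rewrite lt0n mxrank_eq0 (rfix_pgroup_pchar pcharF) ?pcore_pgroup ?pcore_sub.
move=> y Hy nty; rewrite -p'natE // => p'y.
have [x [Hx p'x def_y]] := p'_elt_lift nOH Hy p'y.
have ntx : x != 1 by apply: contraNneq nty => x1; rewrite def_y x1 morph1.
have /rfix_mx_set1_eq0 fix0 : rfix_mx rH [set x] = 0%R.
  by apply: fixH => //; rewrite -p'natE.
(* Seen inside the original module, a vector of [U] fixed by the coset of [x] is fixed by [x]
   itself. *)
apply/rfix_mx_set1_eq0=> v; rewrite def_y quo_repr_coset // => vx.
apply: val_submod_inj; rewrite linear0; apply: fix0.
by rewrite -(val_submodJ modU) //; congr val_submod.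
Qed.

(** [N] is the direct product of its [p]-core and [p^']-core: the first centralises its own centre,
    the second all of ['O_p(N)]. *)
Lemma nilpotent_cent_center_pcore (p : nat) (gT : finGroupType)
    (N : {group gT}) :
  nilpotent N -> N \subset 'C('Z('O_p(N))).
Proof.
move=> nilN; have /dprodP[_ defN cOO _] := nilpotent_pcoreC p nilN.
rewrite -{1}defN mul_subG //.
  by rewrite centsC subIset // subxx orbT.
by rewrite (subset_trans cOO) // centS // center_sub.
Qed.

Lemma order_mul_p_p' (p : nat) (gT : finGroupType) (x v : gT) :
  p^'.-elt x -> #[v] = p -> prime p -> commute x v -> #[x * v] = (#[x] * p)%N.
Proof.
move=> p'x ov p_pr cxv; rewrite orderM ?ov // coprime_sym prime_coprime //.
by rewrite -p'natE.
Qed.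

Lemma equal_order_pair_cent_p'_elt (p : nat) (gT : finGroupType)
    (G N : {group gT}) (x v : gT) :
  equal_order_pair G N -> prime p -> x \in G -> x \notin N -> p^'.-elt x ->
  v \in N -> v ^+ p = 1 -> commute x v -> v = 1.
Proof.
case=> _ _ _ eqo p_pr Gx N'x p'x Nv vp1 cxv; apply/eqP/contraT=> ntv.
have ov : #[v] = p.
  have /(prime_nt_dvdP p_pr)-> // : #[v] %| p by rewrite order_dvdn vp1.
  by rewrite order_eq1.
have Dx : x \in G :\: N by rewrite inE N'x.
have := eqo x (x * v) Dx; rewrite mem_lcoset mulKg => /(_ Nv).
rewrite (order_mul_p_p' p) // => /eqP.
by rewrite -{2}[#[x]]muln1 eqn_pmul2l ?order_gt0 // => /eqP p1;
  rewrite p1 in p_pr.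
Qed.

Theorem proposition5p2 (gT : finGroupType) (G N : {group gT}) (p : nat)
    (GN_eop : equal_order_pair G N) (N_nil : nilpotent N)
    (p_pr : prime p) (p_dvd_N : (p %| #|N|)%N) :
  p'_semiregular p 'F_p (G / N)%G /\
  p'_semiregular p 'F_p (G / N / 'O_p(G / N))%G.
Proof.
suff semiGN : p'_semiregular p 'F_p (G / N)%G.
  by split; last by apply: p'_semiregular_quo_pcore; rewrite ?pchar_Fp.
have [nsNG _ _ _] := GN_eop; have [sNG nNG] := andP nsNG.
have pP : p.-group 'O_p(N) := pcore_pgroup p N.
pose E := 'Ohm_1('Z('O_p(N)))%G.
have abelE : p.-abelem E.
  by apply: Ohm1_abelem; rewrite ?(pgroupS (center_sub _)) ?center_abelian.
have ntE : E :!=: 1.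
  (* Triviality of [E] would pass to the centre and then to the [p]-group ['O_p(N)], which is Sylow
     in the nilpotent [N] and so nontrivial. *)
  rewrite Ohm1_eq1 (center_nil_eq1 (pgroup_nil pP)) -cardG_gt1.
  rewrite (card_Hall (nilpotent_pcore_Hall p N_nil)) p_part_gt1.
  by rewrite mem_primes p_pr cardG_gt0.
have sEZ : E \subset 'Z('O_p(N)) := Ohm_sub 1 _.
have sEN : E \subset N.
  by rewrite (subset_trans sEZ) // (subset_trans (center_sub _)) ?pcore_sub.
(* [E] arises from [N] by characteristic subgroup constructions. *)
have nEG : G \subset 'N(E).
  by rewrite (subset_trans nNG) // !gFnorm_trans.
have kerN : N \subset rker (abelem_repr abelE ntE nEG).
  rewrite rker_abelem subsetI sNG.
  exact: subset_trans (nilpotent_cent_center_pcore p _ _ N_nil) (centS sEZ).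
exists _, (quo_repr kerN nNG); split=> // y Gy nty; rewrite -p'natE // => p'y.
have [x [Gx p'x def_y]] := p'_elt_lift nNG Gy p'y.
have N'x : x \notin N by apply: contra nty => Nx; rewrite def_y coset_id.
apply/rfix_mx_set1_eq0=> v; rewrite def_y quo_repr_coset // => vx.
have Ev := mem_rVabelem abelE ntE v.
apply: (rVabelem_inj abelE ntE); rewrite rVabelem0.
apply: (equal_order_pair_cent_p'_elt p _ G N x) => //.
- exact: (subsetP sEN).
- by have [_ ->] := abelemP p_pr abelE.
(* The action on [E] is conjugation, so a fixed vector is an element commuting with [x]. *)
- by apply/esym/commgP/conjg_fixP; rewrite -(rVabelemJ abelE ntE nEG) // vx.
Qed.
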